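(* Let $d \ge 0$ be an integer, and let $h \in \mathcal{H}$ with $h \ge 656$ be such that \[ 16 d^3 \le \frac{h}{\ln h}. \] Let $n = h+d$ and $\varepsilon = \left(\frac{4d\ln h}{h}\right)^{1/2}$. Then \[ \frac{D(n)}{h^{n/2}} \ge \left(\frac{2}{\pi}\right)^{d/2}\exp(-2.31\,d\varepsilon). \]
   Context: A Hadamard matrix of order $h$ is an $h\times h$ matrix $H$ with entries in $\{\pm1\}$ satisfying $HH^T = hI$. $\mathcal{H}$ denotes the set of positive integers $h$ for which a Hadamard matrix of order $h$ exists. $D(n)$ denotes the maximal determinant of an $n\times n$ matrix with entries in the real interval $[-1,1]$. *)

(* Defs.v *)
From HB Require Import structures.
From mathcomp Require Import all_boot all_order perm all_algebra.
From mathcomp Require Import all_classical all_reals all_analysis.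

Set Implicit Arguments.
Unset Strict Implicit.
Unset Printing Implicit Defensive.

Import Order.TTheory GRing.Theory Num.Theory.
Import numFieldNormedType.Exports.

Local Open Scope classical_set_scope.
Local Open Scope ring_scope.

Definition is_hadamard (h : nat) (H : 'M[int]_h) : Prop :=
  (forall i j, H i j = 1 \/ H i j = -1) /\ H *m H^T = (h%:Z)%:M.

Definition hadamard_orders : set nat :=
  [set h | (0 < h)%N /\ exists H : 'M[int]_h, is_hadamard H].

Definition unit_box (R : realType) (n : nat) : set 'M[R]_n :=
  [set A | forall i j, -1 <= A i j <= 1].

(* [sup] is 0 on sets without a supremum; [max_det_attained] and [max_det_ub]
   show that here it is a maximum. *)
Definition max_det (R : realType) (n : nat) : R :=
  sup [set \det A | A in @unit_box R n].
Arguments max_det : clear implicits.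

Lemma unit_box_EVT (R : realType) (n : nat) :
  exists2 A : 'M[R]_n, unit_box A &
    forall B : 'M[R]_n, unit_box B -> \det B <= \det A.
Proof.
pose K : set 'rV[R]_(n * n) := [set v | forall i, `[-1, 1]%classic (v ord0 i)].
have K0 : K !=set0 by exists 0 => i; rewrite /= mxE in_itv /= lerN10 ler01.
have cK : compact K.
  apply: (@rV_compact R _ (fun=> `[-1, 1]%classic)) => i.
  exact: segment_compact.
have boxK (v : 'rV[R]_(n * n)) : K v -> unit_box (vec_mx v : 'M[R]_n).
  by move=> Kv i j; rewrite mxE; have := Kv (mxvec_index i j); rewrite /= in_itv.
have Kbox (A : 'M[R]_n) : unit_box A -> K (mxvec A).
  by move=> bA k; case/mxvec_indexP: k => i j; rewrite /= mxvecE in_itv /= bA.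
have cdet : {within K, continuous (fun v => \det (vec_mx v : 'M[R]_n))}.
  apply: continuous_subspaceT; rewrite /determinant.
  apply: continuous_big => [x|s _]; first exact: add_continuous.
  have cprod : continuous (fun v : 'rV[R]_(n * n) =>
      \prod_(i < n) (vec_mx v : 'M[R]_n) i (s i)).
    apply: continuous_big => [x|i _]; first exact: mul_continuous.
    under eq_fun do rewrite mxE.
    exact: coord_continuous.
  move=> v; apply: (@continuousM R _ (fun=> (-1) ^+ s)); last exact: cprod.
  exact: cst_continuous.
have [v Kv vmax] := EVT_max_rV K0 cK cdet.
exists (vec_mx v); first exact/boxK/set_mem.
move=> B bB; rewrite -(mxvecK B); apply: vmax; exact/mem_set/Kbox.
Qed.

Lemma max_det_attained (R : realType) (n : nat) :
  exists2 A : 'M[R]_n, unit_box A & \det A = max_det R n.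
Proof.
have [A bA Amax] := unit_box_EVT R n; exists A => //.
have ubA : ubound [set \det B | B in @unit_box R n] (\det A).
  by move=> _ [B bB <-]; exact: Amax.
apply/le_anti/andP; split.
  by apply: ub_le_sup; [exists (\det A) | exists A].
by apply: ge_sup => //; exists (\det A), A.
Qed.

Lemma max_det_ub (R : realType) (n : nat) (B : 'M[R]_n) :
  unit_box B -> \det B <= max_det R n.
Proof.
move=> bB; have [A _ Amax] := unit_box_EVT R n.
apply: ub_le_sup; last by exists B.
by exists (\det A) => _ [C bC <-]; exact: Amax.
Qed.

(* Main.v *)
Require Import Defs.
From HB Require Import structures.
From mathcomp Require Import all_boot all_order perm all_algebra ring lra.
From mathcomp Require Import all_classical all_reals all_analysis.

Set Implicit Arguments.
Unset Strict Implicit.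
Unset Printing Implicit Defensive.

Import Order.TTheory GRing.Theory Num.Theory.
Import numFieldNormedType.Exports.

Local Open Scope classical_set_scope.
Local Open Scope ring_scope.

(* Border a Hadamard matrix A of order h as [A, B; -C, 1], where B is a random
   h x d sign matrix and the i-th row of C is the sign vector of A^T b_i. The
   Schur complement of A is 1 + F, with F = C A^T B / h. The diagonal entries of
   F are l1 norms |A^T b_i|_1 / h: their mean is mu = E|S_h| for the simple
   random walk S, and mu + 1 >= sqrt (2 h / pi) by Wallis' product. They are
   convex and 1-Lipschitz in b_i, so the Efron-Stein inequality bounds their
   variance by 2; off the diagonal E F_il^2 <= 1, because b_l is independent of
   the i-th row of C A^T / h, whose norm is at most 1. Hence some choice of B
   satisfies |F - mu|_F^2 <= 2 d^2, and
   det (1 + E) >= exp (- 2 sqrt d |E|_F) for |E|_F <= 1/2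
   applies to 1 + F = (mu + 1) (1 + E). *)

(** * Averages over the discrete cube *)

Definition flip (I : finType) (i : I) (w : {ffun I -> bool}) : {ffun I -> bool} :=
  [ffun x => w x (+) (x == i)].

Lemma flipE (I : finType) (i : I) w x : flip i w x = w x (+) (x == i).
Proof. exact: ffunE. Qed.

Lemma flipK (I : finType) (i : I) : involutive (flip i).
Proof. by move=> w; apply/ffunP => x; rewrite !flipE -addbA addbb addbF. Qed.

Lemma flipC (I : finType) (i j : I) w : flip i (flip j w) = flip j (flip i w).
Proof. by apply/ffunP => x; rewrite !flipE addbAC. Qed.

Section Cube.
Variables (R : realFieldType) (I : finType).
Implicit Types (f g : {ffun I -> bool} -> R) (w : {ffun I -> bool}) (i : I).

Definition sgnb w i : R := (-1) ^+ w i.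

Definition avg f : R := (#|{ffun I -> bool}|%:R)^-1 * \sum_w f w.

Let N_gt0 : 0 < (#|{ffun I -> bool}|%:R : R).
Proof. by rewrite ltr0n; apply/card_gt0P; exists [ffun=> true]. Qed.

Lemma eq_avg f g : f =1 g -> avg f = avg g.
Proof. by move=> fg; rewrite /avg (eq_bigr g). Qed.

Lemma avgD f g : avg (fun w => f w + g w) = avg f + avg g.
Proof. by rewrite /avg big_split mulrDr. Qed.

Lemma avgZ (c : R) f : avg (fun w => c * f w) = c * avg f.
Proof. by rewrite /avg -mulr_sumr mulrCA. Qed.

Lemma avg_cst (c : R) : avg (fun=> c) = c.
Proof.
by rewrite /avg sumr_const -[X in _ * X]mulr_natl mulKf // gt_eqF.
Qed.

Lemma avg_sum (J : finType) (f : J -> {ffun I -> bool} -> R) :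
  avg (fun w => \sum_j f j w) = \sum_j avg (f j).
Proof. by rewrite /avg exchange_big mulr_sumr. Qed.

Lemma ler_avg f g : (forall w, f w <= g w) -> avg f <= avg g.
Proof. by move=> fg; rewrite /avg ler_pM2l ?invr_gt0// ler_sum. Qed.

Lemma avg_flip i f : avg (f \o flip i) = avg f.
Proof.
rewrite /avg; congr (_ * _).
rewrite [RHS](reindex_inj (inv_inj (flipK i))); exact: eq_bigr.
Qed.

Lemma exists_le_avg f : exists w, f w <= avg f.
Proof.
have [[w le_fw]|no] := pselect (exists w, f w <= avg f); first by exists w.
suff : avg f < avg f by rewrite ltxx.
rewrite -[X in X < _]avg_cst /avg ltr_pM2l ?invr_gt0//.
have f_gt w : avg f < f w by rewrite ltNge; apply/negP => le_fw; apply: no; exists w.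
apply: ltr_sum => [|w _]; last exact: f_gt.
by apply/hasP; exists [ffun=> true]; rewrite ?mem_index_enum.
Qed.

Lemma sgnb_flip i j w : sgnb (flip i w) j = if j == i then - sgnb w j else sgnb w j.
Proof.
rewrite /sgnb flipE; case: eqP => _; last by rewrite addbF.
by rewrite addbT; case: (w j); rewrite ?expr0 ?expr1 ?opprK.
Qed.

Lemma sgnb_sqr w i : sgnb w i ^+ 2 = 1.
Proof. exact: sqrr_sign. Qed.

(** The flip at [i] preserves the mean and negates the integrand. *)
Lemma avg_sgnb_eq0 i f :
  (forall w, f (flip i w) = f w) -> avg (fun w => f w * sgnb w i) = 0.
Proof.
move=> fi; have := avg_flip i (fun w => f w * sgnb w i).
rewrite (@eq_avg _ (fun w => -1 * (f w * sgnb w i))) => [|w /=].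
  by rewrite avgZ; lra.
by rewrite fi sgnb_flip eqxx; ring.
Qed.

(** * Conditional expectations and the Efron-Stein inequality *)

Definition cond i f w : R := (f w + f (flip i w)) / 2.

Lemma avg_cond i f : avg (cond i f) = avg f.
Proof.
transitivity (avg (fun w => 2^-1 * f w + 2^-1 * (f \o flip i) w)).
  by apply: eq_avg => w; rewrite /cond /=; field.
by rewrite avgD !avgZ avg_flip; field.
Qed.

(* Pythagoras: [cond i], the conditional expectation given the coordinates other
   than [i], is an orthogonal projection. *)
Lemma avg_cond_sqr i f :
  avg (fun w => f w ^+ 2) =
  avg (fun w => cond i f w ^+ 2) + avg (fun w => (f w - cond i f w) ^+ 2).
Proof.
rewrite -avgD -(avg_cond i (fun w => f w ^+ 2)) -(avg_cond i (fun w => _ + _)).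
by apply: eq_avg => w; rewrite /cond !flipK; field.
Qed.

Lemma avg_cond_sqr_le i f : avg (fun w => cond i f w ^+ 2) <= avg (fun w => f w ^+ 2).
Proof.
rewrite (avg_cond_sqr i f) lerDl -(avg_cst 0); apply: ler_avg => w; exact: sqr_ge0.
Qed.

Definition conds (s : seq I) f := foldr cond f s.

Lemma avg_conds s f : avg (conds s f) = avg f.
Proof. by elim: s => //= i s IH; rewrite avg_cond. Qed.

(** Where [w] and [w'] differ at the head [i] of [s], [flip i w] agrees with [w'] at [i], so the two
    terms of [cond i] match crosswise. *)
Lemma conds_dep s f w w' :
  (forall i, i \notin s -> w i = w' i) -> conds s f w = conds s f w'.
Proof.
elim: s w w' => [|i s IH] w w' ww' /=; first by congr f; apply/ffunP => i; exact: ww'.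
have wwi j : j != i -> j \notin s -> w j = w' j.
  by move=> ji js; apply: ww'; rewrite inE negb_or ji.
have [wi|wi] := eqVneq (w i) (w' i).
  rewrite /cond; congr ((_ + _) / 2); apply: IH => j js; rewrite ?flipE.
    by have [->//|ji] := eqVneq j i; exact: wwi.
  by have [->//|ji] := eqVneq j i; rewrite ?wi ?wwi.
rewrite /cond addrC; congr ((_ + _) / 2); apply: IH => j js; rewrite ?flipE.
  have [->|ji] := eqVneq j i; last by rewrite addbF wwi.
  by move: wi; case: (w i); case: (w' i).
have [->|ji] := eqVneq j i; last by rewrite addbF wwi.
by move: wi; case: (w i); case: (w' i).
Qed.

Lemma conds_enum f w : conds (enum I) f w = avg f.
Proof.
rewrite -(avg_conds (enum I)) -[LHS]avg_cst; apply: eq_avg => w'.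
by apply: conds_dep => i; rewrite mem_enum.
Qed.

(** Averagings over different coordinates commute, because flips do. *)
Lemma conds_sub_cond i s f w :
  conds s f w - cond i (conds s f) w = conds s (fun w => f w - cond i f w) w.
Proof.
elim: s w => //= j s IH w; rewrite {1}/cond -[RHS]/((_ + _) / 2) -!IH.
by rewrite /cond (flipC i j); field.
Qed.

Lemma avg_conds_sqr_le s f :
  avg (fun w => conds s f w ^+ 2) <= avg (fun w => f w ^+ 2).
Proof. by elim: s => //= i s; exact/le_trans/avg_cond_sqr_le. Qed.

(** Each further averaging over [i] loses, by Pythagoras, the mean square of
    [conds s (f - cond i f)], and [conds s] is a contraction in mean square. *)
Lemma efron_stein_seq s f :
  avg (fun w => f w ^+ 2) <= avg (fun w => conds s f w ^+ 2) +
    \sum_(i <- s) avg (fun w => (f w - cond i f w) ^+ 2).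
Proof.
elim: s => [|i s IH]; first by rewrite big_nil addr0.
rewrite big_cons addrA /=; apply: le_trans IH _; rewrite lerD2r (avg_cond_sqr i).
rewrite lerD2l; under eq_avg do rewrite conds_sub_cond.
exact: avg_conds_sqr_le.
Qed.

(** Averaging over all coordinates leaves the constant [avg f]; the factor 1/4 comes from
    [f - cond i f] being half of the difference under the flip. *)
Lemma efron_stein f :
  avg (fun w => (f w - avg f) ^+ 2) <=
  4^-1 * \sum_i avg (fun w => (f w - f (flip i w)) ^+ 2).
Proof.
have -> : avg (fun w => (f w - avg f) ^+ 2) = avg (fun w => f w ^+ 2) - avg f ^+ 2.
  transitivity (avg (fun w => f w ^+ 2 + ((- 2 * avg f) * f w + avg f ^+ 2))).
    by apply: eq_avg => w; ring.
  by rewrite !avgD avgZ avg_cst; ring.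
rewrite lerBlDl; apply: le_trans (efron_stein_seq (enum I) f) _.
under eq_avg do rewrite conds_enum.
rewrite avg_cst lerD2l big_enum /= mulr_sumr; apply: ler_sum => i _.
by rewrite -avgZ; apply: ler_avg => w; rewrite le_eqVlt /cond; apply/orP; left; apply/eqP; field.
Qed.

Definition walk (phi : R -> R) (x : R) : R := (phi (x + 1) + phi (x - 1)) / 2.

(** [walk] is the transition operator of the simple random walk. Averaging over one coordinate takes
    both of its signs, whatever [a i] is, and so applies [walk] once. *)
Lemma avg_walk (r : seq I) (a : I -> R) (phi : R -> R) :
  uniq r -> (forall i, a i = 1 \/ a i = -1) ->
  avg (fun w => phi (\sum_(i <- r) a i * sgnb w i)) = iter (size r) walk phi 0.
Proof.
move=> + a1; elim: r phi => [|i r IH] phi.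
  by move=> _; under eq_avg do rewrite big_nil; exact: avg_cst.
move=> /= /andP[ir ur]; rewrite -iterS iterSr -IH// -(avg_cond i); apply: eq_avg => w.
rewrite /cond !big_cons sgnb_flip eqxx.
rewrite [X in _ + phi (_ + X)](eq_big_seq (fun j => a j * sgnb w j)) => [|j jr]; last first.
  by rewrite sgnb_flip; case: eqP => // ji; rewrite -ji jr in ir.
set S := \sum_(_ <- _) _; rewrite /walk /sgnb.
by case: (a1 i) => ->; case: (w i); rewrite ?expr0 ?expr1 ?mulrN ?mulr1 ?opprK ?mulN1r ?opprK
  [1 + S]addrC [-1 + S]addrC // [X in X / 2]addrC.
Qed.

End Cube.

(** * Perturbations of the identity *)

(** Block LU factorization. The inverse is an argument so that an explicit one, such as the
    transpose over [h], can be supplied. *)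
Lemma det_schur (R : comPzRingType) (m n : nat) (A Ainv : 'M[R]_m)
    (B : 'M[R]_(m, n)) (C : 'M[R]_(n, m)) (D : 'M[R]_n) : Ainv *m A = 1%:M ->
  \det (block_mx A B C D) = \det A * \det (D - C *m Ainv *m B).
Proof.
move=> AA.
have <- : block_mx 1%:M 0 (C *m Ainv) 1%:M *m
    block_mx A B 0 (D - C *m Ainv *m B) = block_mx A B C D.
  rewrite mulmx_block !mul1mx !mul0mx !addr0 -(mulmxA C) AA mulmx1.
  by rewrite addrC subrK.
by rewrite det_mulmx det_lblock !det1 !mul1r det_ublock.
Qed.

(** Cauchy-Schwarz from (y a - x b)^2 >= 0. This needs division by x y, so vanishing x or y is
    treated apart. *)
Lemma sum_mul_le (R : realFieldType) (I : finType) (a b : I -> R) (x y : R) :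
  0 <= x -> 0 <= y -> \sum_i a i ^+ 2 <= x ^+ 2 -> \sum_i b i ^+ 2 <= y ^+ 2 ->
  \sum_i a i * b i <= x * y.
Proof.
have zero (c e : I -> R) : \sum_i c i ^+ 2 <= 0 -> \sum_i c i * e i = 0.
  move=> c0; apply: big1 => i _.
  have/psumr_eq0P : \sum_i c i ^+ 2 = 0.
    by apply/eqP; rewrite eq_le c0 sumr_ge0// => j _; exact: sqr_ge0.
  move=> /(_ (fun j _ => sqr_ge0 _) i isT) /eqP.
  by rewrite sqrf_eq0 => /eqP ->; rewrite mul0r.
rewrite le_eqVlt => /predU1P[<-|x0]; first by rewrite expr0n mul0r => _ /zero ->.
rewrite le_eqVlt => /predU1P[<-|y0].
  by rewrite expr0n mulr0 => _ /zero e; under eq_bigr do rewrite mulrC; rewrite e.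
move=> ax ay.
have xy0 : 0 < 2 * (x * y) by rewrite !mulr_gt0.
rewrite -(ler_pM2l xy0).
have : \sum_i 2 * (x * y) * (a i * b i) <=
       \sum_i (y ^+ 2 * a i ^+ 2 + x ^+ 2 * b i ^+ 2).
  by apply: ler_sum => i _; have := sqr_ge0 (y * a i - x * b i); lra.
rewrite -mulr_sumr big_split -!mulr_sumr /= => /le_trans -> //.
have : y ^+ 2 * \sum_i a i ^+ 2 <= y ^+ 2 * x ^+ 2 by rewrite ler_wpM2l// sqr_ge0.
have : x ^+ 2 * \sum_i b i ^+ 2 <= x ^+ 2 * y ^+ 2 by rewrite ler_wpM2l// sqr_ge0.
nra.
Qed.

Section Frobenius.
Variable R : realType.

Definition sqnorm m n (A : 'M[R]_(m, n)) : R := \sum_i \sum_j A i j ^+ 2.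

Lemma sqnorm_ge0 m n (A : 'M[R]_(m, n)) : 0 <= sqnorm A.
Proof. by do 2!apply: sumr_ge0 => ? _; exact: sqr_ge0. Qed.

Lemma sqnormZ m n (c : R) (A : 'M[R]_(m, n)) : sqnorm (c *: A) = c ^+ 2 * sqnorm A.
Proof.
rewrite /sqnorm mulr_sumr; apply: eq_bigr => i _.
by rewrite mulr_sumr; apply: eq_bigr => j _; rewrite mxE exprMn.
Qed.

Lemma sqnormD_le m n (A B : 'M[R]_(m, n)) (x y : R) : 0 <= x -> 0 <= y ->
  sqnorm A <= x ^+ 2 -> sqnorm B <= y ^+ 2 -> sqnorm (A + B) <= (x + y) ^+ 2.
Proof.
rewrite /sqnorm !pair_bigA /= => x0 y0 Ax By.
have := sum_mul_le x0 y0 Ax By => AB.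
under eq_bigr do rewrite mxE sqrrD.
rewrite !big_split/= sqrrD; lra.
Qed.

Lemma sqnorm_block m1 m2 n1 n2 (A : 'M[R]_(m1, n1)) (B : 'M[R]_(m1, n2))
    (C : 'M[R]_(m2, n1)) (D : 'M[R]_(m2, n2)) :
  sqnorm (block_mx A B C D) = sqnorm A + sqnorm B + (sqnorm C + sqnorm D).
Proof.
rewrite /sqnorm big_split_ord -!big_split /=; congr (_ + _); apply: eq_bigr => i _;
  rewrite big_split_ord /=; congr (_ + _); apply: eq_bigr => j _;
  by rewrite ?block_mxEul ?block_mxEur ?block_mxEdl ?block_mxEdr.
Qed.

Lemma sqnorm_outer m n (v : 'cV[R]_m) (u : 'rV[R]_n) :
  sqnorm (v *m u) = sqnorm v * sqnorm u.
Proof.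
rewrite /sqnorm mulr_suml; apply: eq_bigr => i _.
rewrite !big_ord1 mulr_sumr; apply: eq_bigr => j _.
by rewrite mxE big_ord1 exprMn.
Qed.

Lemma sqnorm11 (a : R) : sqnorm (a%:M : 'M[R]_1) = a ^+ 2.
Proof. by rewrite /sqnorm !big_ord1 mxE eqxx mulr1n. Qed.


(** For 0 <= t <= 1/2, exp (2 t) (1 - t) >= (1 + 2 t) (1 - t) >= 1. *)
Lemma expRN2_le (p : R) : `|p| <= 1 / 2 -> expR (- (2 * `|p|)) <= 1 + p.
Proof.
move=> p2; have p0 := normr_ge0 p.
have /le_trans -> // : expR (- (2 * `|p|)) <= 1 - `|p|.
  rewrite expRN invf_ple ?posrE ?expR_gt0//; last lra.
  apply: le_trans (expR_ge1Dx _); rewrite -[X in X <= _]mul1r ler_pdivrMr; nra.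
by rewrite lerD2l lerNl; apply: le_trans (ler_norm _) _; rewrite normrN.
Qed.

(** The exponents in the induction for [det_perturb], with [D], [D1] the square roots of d and d +
    1. Cauchy-Schwarz gives |p| + D rho <= D1 tau, and the loss [q], being quadratic, fits into
    delta - tau. *)
Lemma det_perturb_step (p rho q delta D D1 : R) :
  0 <= rho -> 0 <= q -> 0 <= delta -> delta <= 1 / 2 -> 0 <= D -> 0 <= D1 ->
  D1 ^+ 2 = D ^+ 2 + 1 -> p ^+ 2 + rho ^+ 2 + q <= delta ^+ 2 ->
  `|p| + D * (rho + q) <= D1 * delta.
Proof.
move=> rho0 q0 delta0 delta2 D0 D10 D1E le_delta.
pose tau := Num.sqrt (p ^+ 2 + rho ^+ 2).
have tau0 : 0 <= tau by exact: sqrtr_ge0.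
have tauE : tau ^+ 2 = p ^+ 2 + rho ^+ 2 by rewrite sqr_sqrtr// addr_ge0// sqr_ge0.
have p0 := normr_ge0 p; have pE : `|p| ^+ 2 = p ^+ 2 by rewrite real_normK// num_real.
have taudelta : tau <= delta by rewrite -(@ler_pXn2r _ 2)// ?nnegrE//; lra.
have DD1 : D <= D1 by rewrite -(@ler_pXn2r _ 2)// ?nnegrE//; lra.
(* Here delta + tau <= 1, because delta <= 1/2. *)
have qle : q <= delta - tau.
  have : q <= (delta - tau) * (delta + tau) by lra.
  move/le_trans; apply; rewrite -[X in _ <= X]mulr1 ler_wpM2l; lra.
have : `|p| + D * rho <= D1 * tau.
  rewrite -(@ler_pXn2r _ 2)// ?nnegrE ?addr_ge0 ?mulr_ge0//.
  rewrite [X in _ <= X]exprMn tauE D1E -pE.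
  have := sqr_ge0 (D * `|p| - rho); lra.
have : D * q <= D1 * (delta - tau) by apply: ler_pM.
lra.
Qed.

(* Elimination of the first row and column: if E = [p u; v E'], the Schur
   complement of the pivot 1 + p is 1 + E' - v u / (1 + p), whose perturbation
   grows by at most |u| |v| / (1 + p) <= |u|^2 + |v|^2. *)
Lemma det_perturb (d : nat) (E : 'M[R]_d) (delta : R) :
  0 <= delta -> delta <= 1 / 2 -> sqnorm E <= delta ^+ 2 ->
  expR (- (2 * Num.sqrt d%:R * delta)) <= \det (1%:M + E).
Proof.
elim: d E delta => [|d IH] E delta delta0 delta2 Edelta.
  by rewrite det_mx00 sqrtr0 mulr0 mul0r oppr0 expR0.
rewrite -(@submxK _ 1 d 1 d E) in Edelta *.
move: (@ulsubmx _ 1 d 1 d E) (@ursubmx _ 1 d 1 d E)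
  (@dlsubmx _ 1 d 1 d E) (@drsubmx _ 1 d 1 d E) Edelta => P u v E'.
rewrite [P]mx11_scalar; move: (P 0 0) => p {P}.
rewrite (@sqnorm_block 1 d 1 d) sqnorm11 => Edelta.
have u0 := sqnorm_ge0 u; have v0 := sqnorm_ge0 v; have E'0 := sqnorm_ge0 E'.
pose q := sqnorm u + sqnorm v; pose rho := Num.sqrt (sqnorm E').
have rho0 : 0 <= rho by exact: sqrtr_ge0.
have rhoE : rho ^+ 2 = sqnorm E' by rewrite sqr_sqrtr.
have delta4 : delta ^+ 2 <= 1 / 4 by rewrite expr2; nra.
have p2 : `|p| <= 1 / 2.
  rewrite -(@ler_pXn2r _ 2)// ?nnegrE// real_normK ?num_real//; lra.
have p1 : 1 / 2 <= 1 + p by move: p2; rewrite ler_norml; lra.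
have a0 : 1 + p != 0 by rewrite gt_eqF//; lra.
rewrite (_ : 1%:M + _ = block_mx (1 + p)%:M u v (1%:M + E') :> 'M[R]_(1 + d));
  last first.
  by rewrite [X in X + _](scalar_mx_block 1 d) add_block_mx !add0r -raddfD.
rewrite (@det_schur _ 1 d _ ((1 + p)^-1)%:M); last first.
  by rewrite -scalar_mxM mulVf.
rewrite det_scalar1 mul_mx_scalar -scalemxAl -addrA.
(* The first factor bounds the pivot; the second bounds the Schur complement, by induction with
   [rho + q] for [delta]. *)
apply: le_trans
  (_ : expR (- (2 * `|p|)) * expR (- (2 * Num.sqrt d%:R * (rho + q))) <= _).
  rewrite -expRD ler_expR.
  have := @det_perturb_step p rho q delta (Num.sqrt d%:R) (Num.sqrt d.+1%:R).
  rewrite !sqrtr_ge0 !sqr_sqrtr// natr1.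
  have q0 : 0 <= q by exact: addr_ge0.
  move=> /(_ isT q0 delta0 delta2 isT isT erefl).
  have /[swap]/[apply] : p ^+ 2 + sqnorm E' + q <= delta ^+ 2 by rewrite /q; lra.
  by move=> ?; lra.
apply: ler_pM; [exact: expR_ge0 | exact: expR_ge0 | exact: expRN2_le |].
apply: IH; rewrite /q; first lra.
  (* From rho^2 + q <= 1/4: rho + q <= rho - rho^2 + 1/4 <= 1/2. *)
  by rewrite -rhoE in Edelta; have := sqr_ge0 (rho - 1 / 2); have := sqr_ge0 p; lra.
apply: sqnormD_le; rewrite ?rhoE//; first lra.
rewrite -scaleNr sqnormZ sqnorm_outer sqrrN exprVn.
rewrite ler_pdivrMl ?exprn_gt0//; last lra.
have : 1 / 4 <= (1 + p) ^+ 2.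
  have := ler_pM _ _ p1 p1; rewrite -!expr2 => h; lra.
have vu : sqnorm v * sqnorm u <= 1 / 4 * (sqnorm u + sqnorm v) ^+ 2.
  have := sqr_ge0 (sqnorm u - sqnorm v); lra.
by move=> a4; apply: le_trans vu _; rewrite ler_wpM2r ?sqr_ge0.
Qed.

End Frobenius.

(** * Wallis' product and the simple random walk *)

Section Wallis.
Variable R : realType.

(** The probability that the simple random walk is at its origin at time 2 k. *)
Definition cbin (k : nat) : R := 'C(k.*2, k)%:R / 4 ^+ k.

Lemma cbin_gt0 k : 0 < cbin k.
Proof. by rewrite divr_gt0 ?exprn_gt0// ltr0n bin_gt0 -addnn leq_addr. Qed.

Lemma cbinS k : (k.*2.+2)%:R * cbin k.+1 = (k.*2.+1)%:R * cbin k.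
Proof.
have e : (k.+1 * 'C(k.+1.*2, k.+1) = k.*2.+1.*2 * 'C(k.*2, k))%N.
  have /= h1 := mul_bin_diag k.*2.+2 k.
  have /= h2 := mul_bin_down k.*2.+1 k.
  have h3 : (k.*2.+1 - k = k.+1)%N by rewrite subSn -addnn ?leq_addr ?addnK.
  by rewrite [in LHS]doubleS -h1 -(doubleS k) -[k.+1.*2]mul2n -[(k.*2.+1).*2]mul2n -!mulnA h2 h3.
have e' := congr1 (fun n => n%:R : R) e; rewrite !natrM in e'.
rewrite /cbin exprS invfM.
have -> : (k.*2.+2)%:R = 2 * k.+1%:R :> R by rewrite -natrM mul2n.
have -> : 2 * k.+1%:R * ('C(k.+1.*2, k.+1)%:R * (4^-1 / 4 ^+ k)) =
  2 * (k.+1%:R * 'C(k.+1.*2, k.+1)%:R) * (4^-1 / 4 ^+ k) :> R by ring.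
rewrite e' -[(k.*2.+1).*2]mul2n natrM; field; exact/lt0r_neq0/exprn_gt0.
Qed.

Lemma is_derive_sinX (n : nat) (x : R) :
  is_derive x 1 (cos * sin ^+ n.+1 : R -> R)
    (n.+1%:R * sin x ^+ n - n.+2%:R * sin x ^+ n.+2).
Proof.
apply: is_derive_eq; rewrite /GRing.scale /= exprfctE.
have c2 : cos x ^+ 2 = 1 - sin x ^+ 2 by rewrite -(cos2Dsin2 x) addrK.
transitivity (n.+1%:R * sin x ^+ n * cos x ^+ 2 - sin x ^+ n.+2).
  by rewrite !exprS -[_ *+ n.+1]mulr_natl; ring.
by rewrite c2 -[n.+2%:R]natr1 !exprS; ring.
Qed.

(* [I] is the integral of sin^n over [0, pi/2]. *)
Definition wallis (n : nat) (I : R) := exists2 G : R -> R,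
  (forall x : R, is_derive x 1 G (sin x ^+ n)) & G (pi / 2) - G 0 = I.

Lemma wallis0 : wallis 0 (pi / 2).
Proof. by exists id => [x|]; rewrite ?expr0 ?subr0//; exact: is_derive_id. Qed.

Lemma wallis1 : wallis 1 1.
Proof.
exists (fun x => - cos x) => [x|]; last by rewrite cos_pihalf cos0; ring.
by rewrite expr1 -[sin x]opprK; exact: is_deriveN.
Qed.

(** Integration by parts; the boundary term cos sin^(n+1) vanishes at both 0 and pi/2. *)
Lemma wallisSS n I : wallis n I -> wallis n.+2 (n.+1%:R / n.+2%:R * I).
Proof.
move=> [G dG <-].
exists (n.+1%:R / n.+2%:R \*: G + - n.+2%:R^-1 \*: (cos * sin ^+ n.+1)) => [x|].
  have dC := is_derive_sinX n x.
  apply: is_derive_eq.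
  have : n.+2%:R != 0 :> R by rewrite pnatr_eq0.
  by rewrite /GRing.scale /=; move: (n.+2%:R : R) => c c0; field.
by rewrite !fctE /= cos_pihalf sin0 [0 ^+ _]exprS !(mul0r, mulr0) !scaler0 !addr0 -scalerBr.
Qed.

(** Since 0 <= sin <= 1 on [0, pi/2], the difference of the antiderivatives is nondecreasing
    there. *)
Lemma wallis_le m n I J : (n <= m)%N -> wallis m I -> wallis n J -> I <= J.
Proof.
move=> nm [F dF <-] [G dG <-].
have dD x : is_derive x (1 : R) (fun y => G y - F y) (sin x ^+ n - sin x ^+ m).
  exact: is_deriveB.
have pi0 : 0 <= pi / 2 :> R by rewrite divr_ge0// pi_ge0.
suff : G 0 - F 0 <= G (pi / 2) - F (pi / 2) by lra.
apply: (@ger0_derive1_le_cc R (fun y => G y - F y) 0 (pi / 2)); rewrite ?in_itv/= ?lexx ?pi0//.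
- move=> x; rewrite in_itv/= => /andP[x0 xp].
  rewrite derive1E derive_val subr_ge0 ler_wiXn2l// ?sin_le1//.
  by apply/ltW/sin_gt0_pihalf/andP.
- by apply: derivable_within_continuous => x _; exact: ex_derive.
Qed.

Lemma wallis_even k : wallis k.*2 (cbin k * (pi / 2)).
Proof.
elim: k => [|k IH]; first by rewrite /cbin bin0 expr0 divr1 mul1r; exact: wallis0.
rewrite (_ : _ * _ = k.*2.+1%:R / k.*2.+2%:R * (cbin k * (pi / 2))); first exact: wallisSS.
have k0 : k.*2.+2%:R != 0 :> R by rewrite pnatr_eq0.
apply: (mulfI k0); rewrite (mulrA _ (cbin _)) cbinS; by field.
Qed.

Lemma wallis_odd k : wallis k.*2.+1 ((k.*2.+1)%:R * cbin k)^-1.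
Proof.
elim: k => [|k IH]; first by rewrite /cbin bin0 expr0 divr1 mulr1 invr1; exact: wallis1.
rewrite (_ : _^-1 = k.*2.+2%:R / k.*2.+3%:R * (k.*2.+1%:R * cbin k)^-1); first exact: wallisSS.
rewrite -(cbinS k) doubleS.
have : k.*2.+2%:R != 0 :> R by rewrite pnatr_eq0.
have : k.*2.+3%:R != 0 :> R by rewrite pnatr_eq0.
have /lt0r_neq0 := cbin_gt0 k.+1; move: (cbin k.+1) (k.*2.+2%:R : R) (k.*2.+3%:R : R).
by move=> c a b c0 b0 a0; field; rewrite a0 b0 c0.
Qed.

(** Compare the integrals of sin^(2k+1) and sin^(2k). *)
Lemma cbin_sqr_ge k : 2 / pi <= (k.*2.+1)%:R * cbin k ^+ 2.
Proof.
have := wallis_le (leqnSn k.*2) (wallis_odd k) (wallis_even k).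
have c0 := cbin_gt0 k.
have m0 : 0 < k.*2.+1%:R :> R by rewrite ltr0n.
move: (cbin k) (k.*2.+1%:R : R) c0 m0 => c m c0 m0.
rewrite -[_^-1]mul1r ler_pdivrMr ?mulr_gt0// => h.
by rewrite ler_pdivrMr ?pi_gt0//; lra.
Qed.

End Wallis.

(** * Return probabilities and the mean absolute value of the walk *)

Section Walk.
Variable R : realType.
Implicit Types (f g : R -> R) (x : R).

Lemma ler_iter_walk n f g x : (forall y, f y <= g y) ->
  iter n (@walk R) f x <= iter n (@walk R) g x.
Proof.
move=> fg; elim: n x => //= n IH x.
by rewrite /walk ler_pM2r ?invr_gt0// lerD.
Qed.

Lemma iter_walkD n f g x :
  iter n (@walk R) (fun y => f y + g y) x =
  iter n (@walk R) f x + iter n (@walk R) g x.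
Proof. by elim: n x => //= n IH x; rewrite /walk !IH; field. Qed.

Let delta0 x : R := (x == 0)%:R.

Lemma iter_walk_far n x : n%:R < x -> iter n (@walk R) delta0 x = 0.
Proof.
elim: n x => [|n IH] x /=; first by rewrite /delta0 => /lt0r_neq0/negPf ->.
by rewrite -[n.+1%:R]natr1 => nx; rewrite /walk !IH; lra.
Qed.

(** To go from n - 2 k to 0 in n steps, exactly k of them must be upward; the induction is Pascal's
    rule. *)
Lemma iter_walk_bin n k :
  iter n (@walk R) delta0 (n%:R - k.*2%:R) = 'C(n, k)%:R / 2 ^+ n.
Proof.
elim: n k => [|n IH] k.
  rewrite /= /delta0 bin0n expr0 divr1 sub0r oppr_eq0 pnatr_eq0 double_eq0.
  by case: eqP.
rewrite iterS {1}/walk -[n.+1%:R]natr1.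
rewrite (_ : n%:R + 1 - k.*2%:R - 1 = n%:R - k.*2%:R); last by ring.
rewrite IH exprS invfM; case: k => [|k].
  rewrite iter_walk_far; last by rewrite double0 subr0 -addrA ltrDl addr_gt0.
  by rewrite !bin0; ring.
rewrite (_ : n%:R + 1 - k.+1.*2%:R + 1 = n%:R - k.*2%:R); last first.
  by rewrite doubleS -[k.*2.+2%:R]natr1 -[k.*2.+1%:R]natr1; ring.
by rewrite IH binS natrD; ring.
Qed.

Definition mean_abs_walk (n : nat) : R := iter n (@walk R) Num.norm 0.

(** One step from y has mean absolute value at least |y| by convexity, and exactly 1 if y = 0, so
    each visit to 0 gains 1. *)
Lemma mean_abs_walkS n :
  mean_abs_walk n + iter n (@walk R) delta0 0 <= mean_abs_walk n.+1.
Proof.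
rewrite /mean_abs_walk iterSr -iter_walkD; apply: ler_iter_walk => y.
rewrite /walk /delta0; have [->|_] := eqVneq y 0.
  by rewrite /= mulr1n normr0 !add0r normrN normr1; lra.
rewrite addr0 ler_pdivlMr//.
apply: le_trans (ler_normD _ _); rewrite le_eqVlt; apply/orP; left; apply/eqP.
by rewrite -[X in _ * X](ger0_norm (ler0n R 2)) -normrM; congr Num.norm; ring.
Qed.

Lemma mean_abs_walk_nd n : mean_abs_walk n <= mean_abs_walk n.+1.
Proof.
apply: le_trans (mean_abs_walkS n); rewrite lerDl.
have : forall x, 0 <= iter n (@walk R) delta0 x; last exact.
elim: n => [|n IH] x /=; first exact: ler0n.
by rewrite /walk divr_ge0// addr_ge0.
Qed.

(** By [cbinS] the left side grows by [cbin k], which is the gain from the visit to 0 at time 2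
    k. *)
Lemma mean_abs_walk_double k : k.*2%:R * cbin R k <= mean_abs_walk k.*2.
Proof.
elim: k => [|k IH]; first by rewrite mul0r /mean_abs_walk /= normr0.
rewrite doubleS cbinS; apply: le_trans (mean_abs_walk_nd _).
apply: le_trans (mean_abs_walkS _).
have := iter_walk_bin k.*2 k; rewrite subrr => ->.
by rewrite -[_.+1%:R]natr1 mulrDl mul1r -mul2n exprM -natrX lerD// mul2n.
Qed.

(** With N = 2 k + 1 >= n and t = sqrt (2 / (pi N)) one has N t = sqrt (2 N / pi). Here (N - 1) t is
    at most the mean absolute value, as t <= [cbin k], and the summand 1 pays for the last t. *)
Lemma mean_abs_walk_ge n : Num.sqrt (2 * n%:R / pi) <= mean_abs_walk n + 1.
Proof.
pose k := n./2; pose N := k.*2.+1.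
have nN : (n <= N)%N by rewrite /N -[X in (X <= _)%N]odd_double_half -add1n leq_add2r leq_b1.
have uk : k.*2%:R * cbin R k <= mean_abs_walk n.
  apply: le_trans (mean_abs_walk_double k) _.
  rewrite -[n in X in _ <= X]odd_double_half; case: (odd n) => /=; last by rewrite add0n.
  exact: mean_abs_walk_nd.
have pi2 : 2 <= pi :> R by exact: pi_ge2.
have N0 : 0 < N%:R :> R by rewrite ltr0n.
pose t : R := Num.sqrt (2 / (pi * N%:R)).
have t0 : 0 <= t by exact: sqrtr_ge0.
have tE : t ^+ 2 = 2 / (pi * N%:R).
  by rewrite sqr_sqrtr// divr_ge0// mulr_ge0// (le_trans _ pi2).
have t1 : t <= 1.
  rewrite -(@ler_pXn2r _ 2)// ?nnegrE// tE expr1n ler_pdivrMr ?mulr_gt0//; last lra.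
  have : 1 <= N%:R :> R by rewrite ler1n.
  nra.
have tc : t <= cbin R k.
  rewrite -(@ler_pXn2r _ 2)// ?nnegrE// ?(ltW (cbin_gt0 _ _))// tE.
  rewrite invfM mulrA ler_pdivrMr//; by rewrite [X in _ <= X]mulrC cbin_sqr_ge.
apply: (@le_trans _ _ (N%:R * t)).
  rewrite -[X in _ <= X]ger0_norm ?mulr_ge0 ?ler0n// -sqrtr_sqr ler_sqrt ?sqr_ge0//.
  rewrite exprMn tE expr2.
  have -> : N%:R * N%:R * (2 / (pi * N%:R)) = 2 * N%:R / pi :> R.
    by field; rewrite !gt_eqF//; lra.
  by rewrite ler_pM2r ?invr_gt0 ?pi_gt0// ler_pM2l// ler_nat.
rewrite /N -[_.+1%:R]natr1 mulrDl mul1r; apply: lerD t1.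
by apply: le_trans uk; rewrite ler_wpM2l.
Qed.

End Walk.

(** * Bordered Hadamard matrices *)

(** Swapping two rows changes the sign of the determinant. *)
Lemma unit_box_abs_det (R : realType) (n : nat) (A : 'M[R]_n) :
  (1 < n)%N -> unit_box A -> `|\det A| <= max_det R n.
Proof.
case: n A => [|[|n]]// A _ boxA; have [A0|A0] := ger0P (\det A).
  exact: max_det_ub.
have boxA' : unit_box (row_perm (tperm 0 1) A) by move=> i j; rewrite mxE.
by have := max_det_ub boxA'; rewrite row_permE det_mulmx det_perm odd_tperm /= expr1 mulN1r.
Qed.

Section Border.
Variables (R : realType) (h d : nat) (A : 'M[R]_h).
Hypothesis h_gt0 : (0 < h)%N.
Hypothesis A_pm1 : forall i j, A i j = 1 \/ A i j = -1.
Hypothesis A_orth : A^T *m A = h%:R%:M.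

Local Notation I := ('I_h * 'I_d)%type.
Local Notation s := (@sgnb R I).
Implicit Type w : {ffun I -> bool}.

Let hR0 : 0 < h%:R :> R. Proof. by rewrite ltr0n. Qed.

(** For b_i the i-th column of B, [proj w j i] is entry j of A^T b_i, and [dual w j i] is C i j,
    possibly 0. Then [grad w i] is row i of C A^T / h, and [gram] is F. *)
Definition proj w j i : R := \sum_k A k j * s w (k, i).
Definition dual w j i : R := Num.sg (proj w j i).
Definition grad w i k : R := h%:R^-1 * \sum_j A k j * dual w j i.
Definition gram w i l : R := \sum_k grad w i k * s w (k, l).

Lemma sum_dual_proj w w' i :
  h%:R^-1 * \sum_j dual w j i * proj w' j i = \sum_k grad w i k * s w' (k, i).
Proof.
rewrite mulr_sumr.
under eq_bigr do rewrite /proj mulr_sumr mulr_sumr.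
rewrite exchange_big /=; apply: eq_bigr => k _.
by rewrite /grad -mulrA mulr_suml mulr_sumr; apply: eq_bigr => j _; ring.
Qed.

Lemma gram_diag w i : gram w i i = h%:R^-1 * \sum_j `|proj w j i|.
Proof.
rewrite /gram -sum_dual_proj; congr (_ * _); apply: eq_bigr => j _.
by rewrite /dual -normrEsg.
Qed.

Lemma dual_le1 w j i : `|dual w j i| <= 1.
Proof. by rewrite /dual normr_sg; case: (_ != 0). Qed.

(** A / sqrt h is an isometry, so the sum is |v|^2 / h, where v has h entries in [-1, 1]. *)
Lemma sum_grad_sqr_le1 w i : \sum_k grad w i k ^+ 2 <= 1.
Proof.
pose v := \col_j dual w j i.
have gradE k : grad w i k = h%:R^-1 * (A *m v) k 0.
  by rewrite !mxE; congr (_ * _); apply: eq_bigr => j _; rewrite mxE.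
have -> : \sum_k grad w i k ^+ 2 = h%:R^-1 ^+ 2 * ((A *m v)^T *m (A *m v)) 0 0.
  rewrite mxE mulr_sumr; apply: eq_bigr => k _.
  by rewrite gradE exprMn [_^T _ _]mxE -expr2.
rewrite trmx_mul -mulmxA (mulmxA A^T) A_orth mul_scalar_mx -scalemxAr !mxE.
have -> : h%:R^-1 ^+ 2 * (h%:R * \sum_j v^T 0 j * v j 0) =
    h%:R^-1 * \sum_j v^T 0 j * v j 0 by field; rewrite gt_eqF.
rewrite ler_pdivrMl// mulr1.
rewrite -[X in _ <= X%:R]card_ord -sumr_const; apply: ler_sum => j _.
rewrite !mxE -expr2 -[dual _ _ _ ^+ 2]real_normK ?num_real// expr_le1//.
exact: dual_le1.
Qed.

Lemma proj_flip w k l j i : l != i -> proj (flip (k, l) w) j i = proj w j i.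
Proof.
move=> li; apply: eq_bigr => k' _; rewrite sgnb_flip xpair_eqE.
by rewrite [i == l]eq_sym (negPf li) andbF.
Qed.

Lemma grad_flip w k l i k' : l != i -> grad (flip (k, l) w) i k' = grad w i k'.
Proof.
by move=> li; congr (_ * _); apply: eq_bigr => j _; rewrite /dual proj_flip.
Qed.

Lemma avg_gram_diag i : avg (fun w => gram w i i) = mean_abs_walk R h.
Proof.
under eq_avg do rewrite gram_diag.
rewrite avgZ avg_sum.
rewrite (eq_bigr (fun=> mean_abs_walk R h)) => [|j _].
  by rewrite sumr_const card_ord -[X in _ * X]mulr_natl mulKf// gt_eqF.
pose r := [seq (k, i) | k <- enum 'I_h].
have ur : uniq r by rewrite map_inj_uniq ?enum_uniq// => k k' [].
have := @avg_walk R I r (fun x => A x.1 j) Num.norm ur (fun x => A_pm1 x.1 j).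
rewrite size_map -cardE card_ord -/(mean_abs_walk R h) => <-; apply: eq_avg => w.
by rewrite /proj big_map big_enum.
Qed.

(* The sign pattern [dual w] is admissible for the dual description of the l1
   norm [gram w' i i], so [grad w i] is a subgradient. *)
Lemma gram_diag_sub w w' i :
  gram w i i - gram w' i i <= \sum_k grad w i k * (s w (k, i) - s w' (k, i)).
Proof.
under eq_bigr do rewrite mulrBr.
rewrite sumrB lerD2l lerN2 -sum_dual_proj gram_diag.
rewrite ler_pM2l ?invr_gt0//; apply: ler_sum => j _.
apply: le_trans (ler_norm _) _; rewrite normrM.
by rewrite -[X in _ <= X]mul1r ler_wpM2r ?dual_le1.
Qed.

Lemma gram_diag_flip_sub w k i :
  gram w i i - gram (flip (k, i) w) i i <= 2 * `|grad w i k|.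
Proof.
apply: le_trans (gram_diag_sub w _ i) _.
rewrite (bigD1 k)//= big1 ?addr0 => [|k' k'k]; last first.
  by rewrite sgnb_flip xpair_eqE (negPf k'k) /= subrr mulr0.
rewrite sgnb_flip eqxx opprK; apply: le_trans (ler_norm _) _.
rewrite normrM mulrC ler_wpM2r//.
by rewrite -mulr2n normrMn /sgnb normr_sign.
Qed.

(** A decrease under the flip is bounded by the subgradient at [w], an increase by the one at the
    flipped point; the sum covers both signs. *)
Lemma gram_diag_flip_sqr w k i :
  (gram w i i - gram (flip (k, i) w) i i) ^+ 2 <=
  4 * (grad w i k ^+ 2 + grad (flip (k, i) w) i k ^+ 2).
Proof.
have := gram_diag_flip_sub w k i.
have := gram_diag_flip_sub (flip (k, i) w) k i; rewrite flipK.
rewrite -(real_normK (num_real (grad w i k))).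
rewrite -(real_normK (num_real (grad (flip _ w) i k))).
move: (normr_ge0 (grad w i k)) (normr_ge0 (grad (flip (k, i) w) i k)).
move: `|grad w i k| `|grad (flip (k, i) w) i k| => x y x0 y0 hy hx.
set D := gram w i i - _ in hx *.
have {}hy : - D <= 2 * y by rewrite /D opprB.
have [D0|D0] := lerP 0 D.
  have := ler_pM D0 D0 hx hx; rewrite -!expr2 => ?; have := sqr_ge0 y; lra.
have D0' : 0 <= - D by lra.
have := ler_pM D0' D0' hy hy; rewrite -!expr2 sqrrN => ?; have := sqr_ge0 x; lra.
Qed.

(** Only flips in column i matter. Both gradients in [gram_diag_flip_sqr] have the same mean square,
    so the variance is at most 1/4 of 8 times the mean of |grad|^2. *)
Lemma avg_gram_diag_var i :
  avg (fun w => (gram w i i - mean_abs_walk R h) ^+ 2) <= 2.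
Proof.
rewrite -(avg_gram_diag i); apply: le_trans (efron_stein _) _.
rewrite ler_pdivrMl//.
pose V k := avg (fun w => grad w i k ^+ 2).
have le_V (x : I) : avg (fun w => (gram w i i - gram (flip x w) i i) ^+ 2) <=
    if x.2 == i then 8 * V x.1 else 0.
  case: x => k l /=; have [->|li] := eqVneq l i.
    apply: le_trans (ler_avg (fun w => gram_diag_flip_sqr w k i)) _.
    rewrite avgZ avgD (avg_flip (k, i) (fun w => grad w i k ^+ 2)) -/(V k); lra.
  rewrite -[X in _ <= X](avg_cst I); apply: ler_avg => w.
  have -> : gram (flip (k, l) w) i i = gram w i i.
    by rewrite !gram_diag; congr (_ * _); apply: eq_bigr => j _; rewrite proj_flip.
  by rewrite subrr expr0n.
apply: le_trans (ler_sum _ (fun x _ => le_V x)) _.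
rewrite -(pair_bigA _ (fun k l => if l == i then 8 * V k else 0)) /=.
under eq_bigr do rewrite -big_mkcond big_pred1_eq.
rewrite -mulr_sumr -avg_sum.
have -> : 4 * 2 = 8 * avg (fun _ : {ffun I -> bool} => 1) :> R by rewrite avg_cst; ring.
by rewrite ler_pM2l//; apply: ler_avg => w; exact: sum_grad_sqr_le1.
Qed.

(** [grad w i] does not involve column l, so the cross terms average to 0 and |grad|^2 remains. *)
Lemma avg_gram_offdiag_sqr i l : i != l -> avg (fun w => gram w i l ^+ 2) <= 1.
Proof.
move=> il; have li : l != i by rewrite eq_sym.
have -> : avg (fun w => gram w i l ^+ 2) = avg (fun w => \sum_k grad w i k ^+ 2).
  transitivity (avg (fun w => \sum_k \sum_k'
      (grad w i k * s w (k, l)) * (grad w i k' * s w (k', l)))).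
    apply: eq_avg => w; rewrite expr2 /gram mulr_suml; apply: eq_bigr => k _.
    by rewrite mulr_sumr.
  rewrite !avg_sum; apply: eq_bigr => k _; rewrite avg_sum (bigD1 k)//=.
  rewrite big1 ?addr0 => [|k' k'k].
    by apply: eq_avg => w; rewrite -expr2 exprMn sgnb_sqr mulr1.
  rewrite -[RHS](@avg_sgnb_eq0 R I (k', l)
    (fun w => grad w i k * s w (k, l) * grad w i k')) => [|w].
    by apply: eq_avg => w; ring.
  by rewrite !grad_flip// sgnb_flip xpair_eqE eq_sym (negPf k'k).
rewrite -[X in _ <= X](avg_cst I); apply: ler_avg => w; exact: sum_grad_sqr_le1.
Qed.

Lemma exists_gram_near_scalar : exists w,
  sqnorm ((\matrix_(i, l) gram w i l) - (mean_abs_walk R h)%:M) <= 2 * d%:R ^+ 2.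
Proof.
have [w wP] := exists_le_avg (fun w =>
  sqnorm ((\matrix_(i, l) gram w i l) - (mean_abs_walk R h)%:M)).
exists w; apply: le_trans wP _; rewrite /sqnorm avg_sum.
apply: (@le_trans _ _ (\sum_(i < d) \sum_(l < d) 2)); last first.
  rewrite !sumr_const card_ord -[2 *+ d *+ d]mulr_natr -[2 *+ d]mulr_natr; lra.
apply: ler_sum => i _; rewrite avg_sum; apply: ler_sum => l _.
under eq_avg do rewrite !mxE.
have [->|il] := eqVneq i l; first exact: avg_gram_diag_var.
under eq_avg do rewrite mulr0n subr0.
by apply: le_trans (avg_gram_offdiag_sqr il) _; rewrite ler1n.
Qed.

Lemma max_det_border w : (1 < h)%N ->
  `|\det A| * `|\det (1%:M + \matrix_(i < d, l < d) gram w i l)| <= max_det R (h + d).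
Proof.
move=> h1.
pose B : 'M[R]_(h, d) := \matrix_(k, l) s w (k, l).
pose C : 'M[R]_(d, h) := \matrix_(i, j) dual w j i.
rewrite -normrM.
(* The lower left block is -C, which turns the minus sign of the Schur complement into a plus. *)
have -> : 1%:M + \matrix_(i < d, l < d) gram w i l =
    1%:M - (- C) *m (h%:R^-1 *: A^T) *m B.
  rewrite !mulNmx opprK; congr (_ + _); apply/matrixP => i l.
  rewrite !mxE; apply: eq_bigr => k _; rewrite !mxE; congr (_ * _).
  by rewrite /grad mulr_sumr; apply: eq_bigr => j _; rewrite !mxE; ring.
rewrite -det_schur; last first.
  by rewrite -scalemxAl A_orth scale_scalar_mx mulVf// gt_eqF.
apply: unit_box_abs_det; first exact: leq_trans h1 (leq_addr _ _).
have pm1 (x : R) : `|x| <= 1 -> -1 <= x <= 1 by rewrite ler_norml.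
move=> i j; apply: pm1; case: (split_ordP i) => i' ->; case: (split_ordP j) => j' ->.
- by rewrite block_mxEul; case: (A_pm1 i' j') => ->; rewrite ?normrN normr1.
- by rewrite block_mxEur mxE /sgnb normr_sign.
- by rewrite block_mxEdl !mxE normrN dual_le1.
- by rewrite block_mxEdr mxE; case: (_ == _); rewrite ?normr1// normr0.
Qed.

Lemma max_det_ge (delta : R) : (1 < h)%N -> 0 <= delta -> delta <= 1 / 2 ->
  2 * d%:R ^+ 2 <= delta ^+ 2 * (mean_abs_walk R h + 1) ^+ 2 ->
  `|\det A| * ((mean_abs_walk R h + 1) ^+ d * expR (- (2 * Num.sqrt d%:R * delta)))
    <= max_det R (h + d).
Proof.
move=> h1 delta0 delta2 le_delta; set mu := mean_abs_walk R h in le_delta *.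
have mu0 : 0 < mu + 1.
  by apply: lt_le_trans (mean_abs_walk_ge R h); rewrite sqrtr_gt0 divr_gt0 ?mulr_gt0 ?pi_gt0.
have [w wP] := exists_gram_near_scalar; rewrite -/mu in wP.
apply: le_trans (max_det_border w h1); rewrite ler_wpM2l//.
set F := \matrix_(_, _) _ in wP *.
have -> : 1%:M + F = (mu + 1) *: (1%:M + (mu + 1)^-1 *: (F - mu%:M)).
  rewrite scalerDr scalerA divff ?gt_eqF// scale1r scale_scalar_mx mulr1 raddfD /=.
  by rewrite [mu%:M + 1%:M]addrC addrACA subrr addr0.
rewrite detZ normrM ger0_norm ?exprn_ge0 ?(ltW mu0)// ler_wpM2l ?exprn_ge0 ?(ltW mu0)//.
apply: le_trans (ler_norm _); apply: det_perturb => //.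
rewrite sqnormZ exprVn ler_pdivrMl ?exprn_gt0// mulrC.
exact: le_trans wP le_delta.
Qed.

End Border.

(** * Real Hadamard matrices and the final estimate *)

Lemma hadamard_real (R : realType) (h : nat) : hadamard_orders h ->
  exists A : 'M[R]_h, [/\ forall i j, A i j = 1 \/ A i j = -1,
    A^T *m A = h%:R%:M & `|\det A| = h%:R `^ (h%:R / 2)].
Proof.
move=> [h0 [H [Hpm Horth]]]; pose A := map_mx (intr : int -> R) H.
have hR0 : 0 < h%:R :> R by rewrite ltr0n.
have AAT : A *m A^T = h%:R%:M.
  by rewrite /A map_trmx -map_mxM Horth map_scalar_mx /= pmulrn.
exists A; split.
- by move=> i j; rewrite mxE; case: (Hpm i j) => ->; [left|right]; rewrite ?rmorphN rmorph1.
(* A right inverse of a square matrix is also a left inverse. *)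
- have := @mulmx1C R h A (h%:R^-1 *: A^T).
  rewrite -scalemxAr AAT scale_scalar_mx mulVf ?gt_eqF// => /(_ erefl).
  rewrite -scalemxAl => /(congr1 ( *:%R h%:R)).
  by rewrite scalerA divff ?gt_eqF// scale1r scale_scalar_mx mulr1.
- rewrite mulrC powRrM powR12_sqrt ?ler0n//.
  rewrite powR_mulrn ?sqrtr_ge0// -(ger0_norm (exprn_ge0 _ (sqrtr_ge0 _))).
  apply/eqP; rewrite -(@eqrXn2 _ 2)// !real_normK ?num_real//.
  by rewrite exprAC sqr_sqrtr ?ler0n// -(det_scalar h h%:R) -AAT det_mulmx det_tr expr2.
Qed.

Theorem theorem2 (R : realType) (d h : nat) (hH : hadamard_orders h)
    (h656 : (656 <= h)%N)
    (hd : 16 * d%:R ^+ 3 <= h%:R / ln (h%:R : R)) :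
  let n := (h + d)%N in
  let eps : R := Num.sqrt (4 * d%:R * ln h%:R / h%:R) in
  max_det R n / h%:R `^ (n%:R / 2) >=
    (2 / pi) `^ (d%:R / 2) * expR (- (231 / 100) * d%:R * eps).
Proof.
lazy zeta; set n := (h + d)%N; set eps : R := Num.sqrt _.
have h0 : (0 < h)%N by exact: leq_trans h656.
have h1 : (1 < h)%N by exact: leq_trans h656.
have hR0 : 0 < h%:R :> R by rewrite ltr0n.
have pi0 : 0 < pi :> R by exact: pi_gt0.
have pi4 : pi <= 4 :> R by have := pihalf_lt2 R; lra.
(* ln (1/2) <= -1/2 gives ln 4 >= 1. *)
have ln1 : 1 <= ln (h%:R : R).
  have ln2 : 1 / 2 <= ln (2 : R).
    have := @le_ln1Dx R (- (1 / 2)); rewrite (_ : 1 + - (1 / 2) = 2^-1); last by field.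
    rewrite lnV ?posrE// => /(_ ltac:(lra)); lra.
  apply: (@le_trans _ _ (ln (2 ^+ 2))).
    by rewrite lnXn// mulr2n; lra.
  by rewrite ler_ln ?posrE ?exprn_gt0// -natrX ler_nat (leq_trans _ h656).
have d0 : 0 <= d%:R :> R by exact: ler0n.
have [A [A_pm1 A_orth detA]] := hadamard_real R hH.
(* Chosen so that delta^2 (2 h / pi) = 2 d^2, the bound of [exists_gram_near_scalar]. *)
pose delta : R := d%:R * Num.sqrt (pi / h%:R).
have delta0 : 0 <= delta by rewrite mulr_ge0 ?sqrtr_ge0.
have deltaE : delta ^+ 2 = d%:R ^+ 2 * (pi / h%:R).
  by rewrite exprMn sqr_sqrtr// divr_ge0 ?ltW.
have d2 : 16 * d%:R ^+ 2 <= h%:R :> R.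
  apply: (@le_trans _ _ (16 * d%:R ^+ 3)).
    rewrite ler_pM2l// exprS; case: (d) => [|d']; first by rewrite mul0r expr0n.
    by rewrite ler_peMl ?exprn_ge0// ler1n.
  apply: le_trans hd _; rewrite ler_pdivrMr; last lra.
  by rewrite ler_peMr// ltW.
have delta2 : delta <= 1 / 2.
  rewrite -(@ler_pXn2r _ 2)// ?nnegrE// deltaE mulrA ler_pdivrMr//.
  have : d%:R ^+ 2 * pi <= d%:R ^+ 2 * 4 :> R by rewrite ler_wpM2l ?exprn_ge0.
  lra.
set mu1 := mean_abs_walk R h + 1.
have mu1_ge : Num.sqrt (2 * h%:R / pi) <= mu1 by exact: mean_abs_walk_ge.
have le_delta : 2 * d%:R ^+ 2 <= delta ^+ 2 * mu1 ^+ 2.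
  have -> : 2 * d%:R ^+ 2 = delta ^+ 2 * Num.sqrt (2 * h%:R / pi) ^+ 2.
    rewrite deltaE sqr_sqrtr; last by rewrite divr_ge0 ?mulr_ge0 ?ltW.
    move: (lt0r_neq0 hR0) (lt0r_neq0 pi0); move: (pi : R) => p hn0 p0.
    by field; rewrite p0 hn0.
  rewrite ler_wpM2l ?sqr_ge0// ler_pXn2r ?nnegrE ?sqrtr_ge0//.
  exact: le_trans mu1_ge.
have := max_det_ge h0 A_pm1 A_orth h1 delta0 delta2 le_delta.
rewrite -/mu1 detA ler_pdivlMr ?powR_gt0//; apply: le_trans.
(* The factor h^(h/2) cancels against |det A|; h^(d/2) joins (2/pi)^(d/2) to form sqrt (2 h / pi)^d,
   which is at most mu1^d. *)
rewrite /n (natrD _ h d) (mulrDl h%:R) powRD; last by rewrite (gt_eqF hR0) implybT.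
have tpi0 : 0 <= 2 / pi :> R by rewrite divr_ge0// ltW.
rewrite [X in X <= _]mulrCA ler_wpM2l ?powR_ge0// mulrAC -powRM//.
rewrite [d%:R / 2]mulrC powRrM powR12_sqrt; last exact: mulr_ge0.
rewrite powR_mulrn ?sqrtr_ge0// [2 / pi * _]mulrAC.
apply: ler_pM; [by rewrite exprn_ge0// sqrtr_ge0 | exact: expR_ge0 | |].
  by rewrite lerXn2r ?nnegrE ?sqrtr_ge0//; exact: le_trans mu1_ge.
(* As pi <= 4 <= 4 ln h, the exponent 2 sqrt d delta is at most 2 d eps, within 2.31 d eps. *)
have le_eps : Num.sqrt d%:R * Num.sqrt (pi / h%:R) <= eps.
  rewrite -sqrtrM// ler_sqrt; last by rewrite divr_ge0 ?mulr_ge0 ?ler0n//; lra.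
  rewrite mulrA ler_pM2r ?invr_gt0// [4 * _]mulrC -mulrA ler_wpM2l//; lra.
have eps0 : 0 <= eps by exact: sqrtr_ge0.
rewrite ler_expR /delta.
have := ler_wpM2l d0 le_eps; have := mulr_ge0 d0 eps0; lra.
Qed.
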